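(* Let $G=T^*H_1(\mathbb{R})$. Up to isomorphism, a lattice $\Gamma$ of $G$ is characterized by three positive integers $d_1,d_2,d_3$ with $1\le d_1\mid d_2\mid d_3$. More precisely, for every lattice $\Gamma$ of $G$ there is a unique triple of positive integers $(d_1,d_2,d_3)$ with $d_1\mid d_2\mid d_3$ such that $\Gamma$ is isomorphic to the group $$\Gamma_{d_1,d_2,d_3}=\{(a_1,a_2,a_3,b_1,b_2,b_3):\ a_i,b_j\in\mathbb{Z}\}$$ with multiplication $$(a_i,b_j)(a_i',b_j')=(a_1+a_1'+d_1b_2b_3',\ a_2+a_2'+d_2b_3b_1',\ a_3+a_3'+d_3b_1b_2',\ b_1+b_1',\ b_2+b_2',\ b_3+b_3').$$
   Context: $H_1(\mathbb{R})$ is the 3-dimensional real Heisenberg group with Lie algebra $\mathcal{H}_1$. $T^*H_1(\mathbb{R})$ denotes the simply connected Lie group whose Lie algebra is the semidirect product of $\mathcal{H}_1$ with the abelian Lie algebra $\mathcal{H}_1^*$ via the coadjoint action. This Lie algebra is isomorphic to $\mathbb{R}^3\oplus\Lambda^2(\mathbb{R}^3)$ with bracket $[(x,u),(y,v)]=(0,x\wedge y)$, and $G$ is isomorphic to $\mathbb{R}^6$ with the product $$(x_i,y_j)(x_i',y_j')=(x_1+x_1'+y_2y_3',\ x_2+x_2'+y_3y_1',\ x_3+x_3'+y_1y_2',\ y_1+y_1',\ y_2+y_2',\ y_3+y_3').$$ A lattice of $G$ is a discrete cocompact subgroup. *)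

(* Defs.v *)
From HB Require Import structures.
From mathcomp Require Import all_boot all_order all_algebra.
From mathcomp Require Import all_classical all_reals all_analysis.
From mathcomp Require Import ring.

Set Implicit Arguments.
Unset Strict Implicit.
Unset Printing Implicit Defensive.

Import GRing.Theory numFieldNormedType.Exports.

Local Open Scope classical_set_scope.
Local Open Scope ring_scope.

Definition group_iso (G H : groupType) : Prop :=
  exists f : {multiplicative G -> H}, bijective f.

Section Subgroups.
Local Open Scope group_scope.
Variables (G : groupType) (S : groupClosed G).

Definition subgroup_type := {x : G | x \in S}.

HB.instance Definition _ := SubChoice.on subgroup_type.

Lemma subgroup_type_closed : group_closed (fun x : G => x \in S).
Proof. by split=> [|x y Sx Sy]; [exact: gpred1 | exact: gpredF]. Qed.

HB.instance Definition _ :=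
  SubChoice_isSubGroup.Build G (fun x : G => x \in S) subgroup_type
    subgroup_type_closed.

(* x S = y S *)
Definition same_lcoset : rel G := fun x y => x^-1 * y \in S.

Lemma same_lcoset_refl : reflexive same_lcoset.
Proof. by move=> x; rewrite /same_lcoset mulVg gpred1. Qed.

Lemma same_lcoset_sym : symmetric same_lcoset.
Proof. by move=> x y; rewrite /same_lcoset -gpredV invgM invgK. Qed.

Lemma same_lcoset_trans : transitive same_lcoset.
Proof.
move=> y x z; rewrite /same_lcoset => Sxy Syz.
by rewrite -(mulgK y x^-1) -mulgA gpredM.
Qed.

Canonical same_lcoset_equiv :=
  EquivRel same_lcoset same_lcoset_refl same_lcoset_sym same_lcoset_trans.

Definition lcoset_space := {eq_quot same_lcoset}%qT.

HB.instance Definition _ := EqQuotient.on lcoset_space.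

End Subgroups.

(* The simply connected Lie group T^*H_1(R), whose Lie algebra is
   R^3 + Lambda^2(R^3) with [(x, u), (y, v)] = (0, x /\ y).  It is given in
   global coordinates on R^6: (y1, y2, y3) is the R^3 part, and (x1, x2, x3)
   is the central part, with Lambda^2(R^3) identified with R^3 by the cross
   product. *)
Section CotangentHeisenberg.
Variable R : realType.

Definition cotangent_heisenberg : Type := (R * R * R * R * R * R)%type.
Local Notation G := cotangent_heisenberg.

HB.instance Definition _ :=
  Topological.copy G (R * R * R * R * R * R)%type.

Definition cotangent_heisenberg_one : G := (0, 0, 0, 0, 0, 0).

Definition cotangent_heisenberg_mul (g g' : G) : G :=
  let: (x1, x2, x3, y1, y2, y3) := g in
  let: (x1', x2', x3', y1', y2', y3') := g' in
  (x1 + x1' + y2 * y3', x2 + x2' + y3 * y1', x3 + x3' + y1 * y2',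
   y1 + y1', y2 + y2', y3 + y3').

Definition cotangent_heisenberg_inv (g : G) : G :=
  let: (x1, x2, x3, y1, y2, y3) := g in
  (- x1 + y2 * y3, - x2 + y3 * y1, - x3 + y1 * y2, - y1, - y2, - y3).

Lemma cotangent_heisenberg_mulA : associative cotangent_heisenberg_mul.
Proof.
move=> [[[[[? ?] ?] ?] ?] ?] [[[[[? ?] ?] ?] ?] ?] [[[[[? ?] ?] ?] ?] ?] /=.
by congr (_, _, _, _, _, _); ring.
Qed.

Lemma cotangent_heisenberg_mul1g :
  left_id cotangent_heisenberg_one cotangent_heisenberg_mul.
Proof. by move=> [[[[[? ?] ?] ?] ?] ?] /=; congr (_, _, _, _, _, _); ring. Qed.

Lemma cotangent_heisenberg_mulg1 :
  right_id cotangent_heisenberg_one cotangent_heisenberg_mul.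
Proof. by move=> [[[[[? ?] ?] ?] ?] ?] /=; congr (_, _, _, _, _, _); ring. Qed.

Lemma cotangent_heisenberg_mulVg : left_inverse cotangent_heisenberg_one
  cotangent_heisenberg_inv cotangent_heisenberg_mul.
Proof. by move=> [[[[[? ?] ?] ?] ?] ?] /=; congr (_, _, _, _, _, _); ring. Qed.

Lemma cotangent_heisenberg_mulgV : right_inverse cotangent_heisenberg_one
  cotangent_heisenberg_inv cotangent_heisenberg_mul.
Proof. by move=> [[[[[? ?] ?] ?] ?] ?] /=; congr (_, _, _, _, _, _); ring. Qed.

HB.instance Definition _ := isGroup.Build G
  cotangent_heisenberg_mulA cotangent_heisenberg_mul1g
  cotangent_heisenberg_mulg1 cotangent_heisenberg_mulVg
  cotangent_heisenberg_mulgV.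

Definition discrete_subgroup (Gam : groupClosed G) : Prop :=
  [set` Gam] `<=` isolated [set` Gam].

Definition cocompact_subgroup (Gam : groupClosed G) : Prop :=
  compact [set: quotient_topology (lcoset_space Gam)].

Definition lattice (Gam : groupClosed G) : Prop :=
  discrete_subgroup Gam /\ cocompact_subgroup Gam.

End CotangentHeisenberg.

(* The parameters are phantom in the carrier; they only select the group law. *)
Definition lattice_model (d1 d2 d3 : nat) : Type :=
  (int * int * int * int * int * int)%type.

Section LatticeModel.
Variables d1 d2 d3 : nat.
Local Notation L := (lattice_model d1 d2 d3).

HB.instance Definition _ :=
  Choice.copy L (int * int * int * int * int * int)%type.

Definition lattice_model_one : L := (0, 0, 0, 0, 0, 0).

Definition lattice_model_mul (g g' : L) : L :=
  let: (a1, a2, a3, b1, b2, b3) := g in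
  let: (a1', a2', a3', b1', b2', b3') := g' in
  (a1 + a1' + d1%:Z * b2 * b3', a2 + a2' + d2%:Z * b3 * b1',
   a3 + a3' + d3%:Z * b1 * b2', b1 + b1', b2 + b2', b3 + b3').

Definition lattice_model_inv (g : L) : L :=
  let: (a1, a2, a3, b1, b2, b3) := g in
  (- a1 + d1%:Z * b2 * b3, - a2 + d2%:Z * b3 * b1, - a3 + d3%:Z * b1 * b2,
   - b1, - b2, - b3).

Lemma lattice_model_mulA : associative lattice_model_mul.
Proof.
move=> [[[[[? ?] ?] ?] ?] ?] [[[[[? ?] ?] ?] ?] ?] [[[[[? ?] ?] ?] ?] ?] /=.
by congr (_, _, _, _, _, _); ring.
Qed.

Lemma lattice_model_mul1g : left_id lattice_model_one lattice_model_mul.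
Proof. by move=> [[[[[? ?] ?] ?] ?] ?] /=; congr (_, _, _, _, _, _); ring. Qed.

Lemma lattice_model_mulg1 : right_id lattice_model_one lattice_model_mul.
Proof. by move=> [[[[[? ?] ?] ?] ?] ?] /=; congr (_, _, _, _, _, _); ring. Qed.

Lemma lattice_model_mulVg :
  left_inverse lattice_model_one lattice_model_inv lattice_model_mul.
Proof. by move=> [[[[[? ?] ?] ?] ?] ?] /=; congr (_, _, _, _, _, _); ring. Qed.

Lemma lattice_model_mulgV :
  right_inverse lattice_model_one lattice_model_inv lattice_model_mul.
Proof. by move=> [[[[[? ?] ?] ?] ?] ?] /=; congr (_, _, _, _, _, _); ring. Qed.

HB.instance Definition _ := isGroup.Build L
  lattice_model_mulA lattice_model_mul1g lattice_model_mulg1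
  lattice_model_mulVg lattice_model_mulgV.

End LatticeModel.

(* Main.v *)
From HB Require Import structures.
Require Import Defs.
From mathcomp Require Import all_boot all_order all_algebra.
From mathcomp Require Import all_classical all_reals all_analysis.
From mathcomp Require Import ring lra.

(** Let [Z] be the intersection of the lattice with the centre R^3 and [P] its
    projection to the coordinates (y1, y2, y3).  Cocompactness makes [P]
    relatively dense in R^3, so [P] contains a basis of R^3, and the commutators
    of lifts of that basis, which are its cross products, are independent vectors
    of [Z].  Hence [Z] is a full lattice.  Moreover [P] is discrete: a short
    vector of [P] has short cross products with the chosen basis, and these lie
    in the discrete group [Z], so they vanish.

    For bases [B] of [P] and [E] of [Z], the commutator pairing is the integer
    matrix [C] with [cofmx B = C E].  If [C = L D U] is its Smith normal form,
    replacing [B] by [L^T B] multiplies [cofmx B] by [cofmx L^T], which is plus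
    or minus [L^-1]; this leaves [C] diagonal, and lifting the new basis of [P]
    gives the isomorphism with the model.

    Conversely, an isomorphism between two models restricts to an isomorphism
    between their centres Z^3 that respects the commutator subgroups
    d1 Z x d2 Z x d3 Z.  It therefore preserves d1 (the content of the commutator
    subgroup), d3 (the exponent of its quotient) and d1 d2 d3 (its index). *)

Set Implicit Arguments.
Unset Strict Implicit.
Unset Printing Implicit Defensive.

Import Order.TTheory GRing.Theory Num.Theory numFieldNormedType.Exports.

Local Open Scope ring_scope.

(** The standard vectors generate Z^n as a group. This reduces membership in a lattice and the
    matrix form of a homomorphism to standard vectors. *)
Lemma int_rV_ind n (S : 'rV[int]_n -> Prop) : S 0 ->
  (forall a b, S a -> S b -> S (a - b)) -> (forall i, S (delta_mx 0 i)) ->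
  forall a, S a.
Proof.
move=> S0 SB Se a.
have SN b : S b -> S (- b) by rewrite -sub0r; exact: SB.
have SD b c : S b -> S c -> S (b + c).
  by move=> Sb /SN; rewrite -{2}[c]opprK; exact: SB.
have Sn b m : S b -> S (b *+ m).
  by move=> Sb; elim: m => [|m IH]; rewrite ?mulr0n // mulrS; exact: SD.
rewrite [a]row_sum_delta; apply: big_ind => // i _.
rewrite -[a 0 i]intz scaler_int; case: (a 0 i) => m; first exact: Sn.
by rewrite NegzE mulrNz; apply: SN; exact: Sn.
Qed.

(** * Discrete subgroups of full rank *)

Lemma truncn_close (R : archiRealFieldType) (q : nat) (x y : R) :
  (0 < q)%N -> 0 <= x -> 0 <= y ->
  Num.truncn (q%:R * x) = Num.truncn (q%:R * y) -> `|x - y| < q%:R^-1.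
Proof.
move=> q0 x0 y0 E.
have q0' : 0 < q%:R :> R by rewrite ltr0n.
have /andP[x1 x2] := truncn_itv (mulr_ge0 (ltW q0') x0).
have /andP[y1 y2] := truncn_itv (mulr_ge0 (ltW q0') y0).
rewrite -E -natr1 in y1 y2; rewrite -natr1 in x2.
rewrite -(ltr_pM2l q0') mulfV ?gt_eqF // -{1}(ger0_norm (ltW q0')) -normrM.
by rewrite mulrBr ltr_norml; apply/andP; split; lra.
Qed.

Definition fracpart (R : archiRealFieldType) (x : R) := x - (Num.floor x)%:~R.

Lemma fracpart_itv (R : archiRealFieldType) (x : R) : 0 <= fracpart x < 1.
Proof.
have /andP[] := floor_itv x; rewrite /fracpart rmorphD /= => h1 h2.
by apply/andP; split; lra.
Qed.

Section EuclideanLattices.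
Variables (R : archiRealFieldType) (n : nat) (L : zmodClosed 'rV[R]_n).

Lemma intcomb_in (m : nat) (A : 'M[R]_(m, n)) (z : 'rV[int]_m) :
  (forall i, row i A \in L) -> map_mx intr z *m A \in L.
Proof.
move=> LA; rewrite mulmx_sum_row rpred_sum // => i _.
by rewrite mxE scaler_int rpredMz.
Qed.

Hypothesis discL : exists2 e, 0 < e &
  forall v, v \in L -> (forall i, `|v 0 i| < e) -> v = 0.

(** Confines [L] between the span of the rows of [V] and a fixed fraction of it, so that
    determinants of vectors of [L] take discrete values. *)
Lemma common_denominator (V : 'M[R]_n) : (forall i, row i V \in L) ->
  V \in unitmx ->
  exists2 m, (0 < m)%N & forall v, v \in L ->
    exists z : 'rV[int]_n, m%:R *: v = map_mx intr z *m V.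
Proof.
move=> LV Vu; have [e e0 discr] := discL.
(* If [r] has entries at most 1/q, then those of [r *m V] are at most K/q, which is below [e] by the
   choice of [q]. *)
pose K := 1 + \sum_i \sum_j `|V i j|.
have K0 : 0 < K.
  by rewrite ltr_pwDl // sumr_ge0 // => i _; rewrite sumr_ge0.
pose q := (Num.bound (K / e)).+1.
have q0 : 0 < q%:R :> R by rewrite ltr0n.
have qK : K / e < q%:R.
  by rewrite (lt_trans (archi_boundP (ltW (divr_gt0 K0 e0)))) // ltr_nat.
pose T := {ffun 'I_n -> 'I_q}.
exists (#|T|)`! => [|v Lv]; first exact: fact_gt0.
have [c vE] : exists c : 'rV_n, v = c *m V.
  by exists (v *m invmx V); rewrite mulmxKV.
(* Two of the multiples k c have fractional parts in the same cell of side 1/q,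
   so the difference of these multiples is within 1/q of an integer vector. *)
pose fr (k : nat) i := fracpart (k%:R * c 0 i).
pose f (k : 'I_#|T|.+1) : T := [ffun i => inord (Num.truncn (q%:R * fr k i))].
have /injectivePn[k1 [k2 k12 fk]] : ~~ injectiveb f.
  by apply/negP => /injectiveP /leq_card; rewrite card_ord ltnn.
wlog lt12 : k1 k2 k12 fk / (k1 < k2)%N.
  move=> W; have [lt|lt|/val_inj eq] := ltngtP k1 k2.
  - exact: (W k1 k2).
  - by apply: (W k2 k1) => //; rewrite eq_sym.
  - by rewrite eq eqxx in k12.
have trlt (k : nat) i : (Num.truncn (q%:R * fr k i) < q)%N.
  have /andP[f0 f1] := fracpart_itv (k%:R * c 0 i).
  have /truncn_itv/andP[t1 _] : 0 <= q%:R * fr k i by rewrite mulr_ge0 // ltW.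
  by rewrite -(ltr_nat R) (le_lt_trans t1) // -{2}[q%:R]mulr1 ltr_pM2l.
have close i : `|fr k1 i - fr k2 i| < q%:R^-1.
  apply: truncn_close => //.
  - by have /andP[] := fracpart_itv (k1%:R * c 0 i).
  - by have /andP[] := fracpart_itv (k2%:R * c 0 i).
  by move/ffunP/(_ i): fk; rewrite !ffunE => /(congr1 val) /=; rewrite !inordK.
pose z : 'rV[int]_n :=
  \row_i (Num.floor (k2%:R * c 0 i) - Num.floor (k1%:R * c 0 i)).
pose r : 'rV[R]_n := \row_i (fr k2 i - fr k1 i).
have dE : (k2 - k1)%:R *: v = map_mx intr z *m V + r *m V.
  rewrite {1}vE scalemxAl -mulmxDl; congr (_ *m _); apply/rowP => i.
  by rewrite !mxE natrB 1?ltnW // /fr /fracpart rmorphB /=; ring.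
have rV0 : r *m V = 0.
  apply: discr.
    have -> : r *m V = (k2 - k1)%:R *: v - map_mx intr z *m V.
      by rewrite dE addrC addKr.
    by rewrite rpredB ?intcomb_in // scaler_nat rpredMn.
  move=> j; rewrite mxE.
  apply: (@le_lt_trans _ _ (q%:R^-1 * K)); last first.
    by rewrite mulrC ltr_pdivrMr // mulrC -ltr_pdivrMr.
  apply: le_trans (ler_norm_sum _ _ _) _.
  rewrite /K mulrDr mulr1 mulr_sumr ler_wpDl ?invr_ge0 ?ler0n //.
  apply: ler_sum => i _.
  rewrite normrM ler_pM //; first by rewrite mxE distrC ltW.
  by rewrite (bigD1 j) //= lerDl sumr_ge0.
rewrite rV0 addr0 in dE.
(* The difference lies between 1 and [#|T|], so the factorial is a denominator valid for every
   [v]. *)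
have dvd : (k2 - k1 %| (#|T|)`!)%N.
  rewrite dvdn_fact // subn_gt0 lt12 leq_subLR.
  by rewrite (leq_trans _ (leq_addl _ _)) // -ltnS.
exists (((#|T|)`! %/ (k2 - k1))%:Z *: z).
rewrite -{1}(divnK dvd) natrM -scalerA dE map_mxZ -scalemxAl.
by congr (_ *: _).
Qed.

Lemma lattice_basis (V : 'M[R]_n) : (forall i, row i V \in L) ->
  V \in unitmx ->
  exists2 B : 'M[R]_n, B \in unitmx & forall v, v \in L <->
    exists z : 'rV[int]_n, v = map_mx intr z *m B.
Proof.
move=> LV Vu; have [m m0 mP] := common_denominator LV Vu.
have V0 : \det V != 0 by rewrite -unitfE -unitmxE.
(* The basis is a matrix [X] with rows in [L] of minimal nonzero determinant;
   [m%:R ^+ n * \det X / \det V] is an integer, so the minimum exists. *)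
pose P N := `[< exists X : 'M[R]_n, [/\ X \in unitmx, forall i, row i X \in L &
  m%:R ^+ n * `|\det X| = N%:R * `|\det V|] >].
have index (X : 'M[R]_n) : (forall i, row i X \in L) ->
    exists N : nat, m%:R ^+ n * `|\det X| = N%:R * `|\det V|.
  move=> LX; have /choice[z zE] i := mP _ (LX i).
  pose Z : 'M[int]_n := \matrix_i z i.
  exists `|\det Z|%N.
  have ZE : m%:R *: X = map_mx intr Z *m V.
    by apply/row_matrixP => i; rewrite linearZ /= zE row_mul -map_row rowK.
  have := congr1 (fun M => `|\det M|) ZE.
  rewrite detZ det_mulmx !normrM normrX ger0_norm // det_map_mx => ->.
  by rewrite -intr_norm -abszE.
have exP : exists N, P N.
  by have [N NE] := index V LV; exists N; apply/asboolP; exists V; split.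
case: (ex_minnP exP) => N /asboolP[X [Xu LX NE]] Nmin.
exists X => // v; split=> [Lv|[z ->]]; last exact: intcomb_in.
have [c vE] : exists c : 'rV_n, v = c *m X.
  by exists (v *m invmx X); rewrite mulmxKV.
pose z : 'rV[int]_n := \row_i Num.floor (c 0 i).
pose f : 'rV[R]_n := \row_i fracpart (c 0 i).
have cE : c = map_mx intr z + f.
  by apply/rowP => i; rewrite !mxE /fracpart; ring.
exists z; suff f0 : f = 0 by rewrite vE cE f0 addr0.
apply/rowP => i; rewrite [RHS]mxE; apply/eqP/negPn/negP => fi0.
have /andP[f_ge0 f_lt1] : 0 <= f 0 i < 1 by rewrite mxE fracpart_itv.
have Lw : f *m X \in L.
  have -> : f *m X = v - map_mx intr z *m X.
    by rewrite vE cE mulmxDl addrC addKr.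
  by rewrite rpredB ?intcomb_in.
(* Exchanging row [i] for the remainder [f *m X] scales the determinant by [f 0 i], strictly between
   0 and 1, against minimality. *)
pose X' : 'M[R]_n := \matrix_k (if k == i then f *m X else row k X).
have detX' : \det X' = f 0 i * \det X.
  rewrite (expand_det_row _ i).
  (* [X] and [X'] have the same cofactors along row [i], so the expansion is an entry of
     [f *m X *m \adj X], a multiple of [f]. *)
  transitivity ((f *m X *m \adj X) 0 i); last first.
    by rewrite -mulmxA mul_mx_adj mul_mx_scalar mxE mulrC.
  rewrite [RHS]mxE; apply: eq_bigr => j _; rewrite [\adj X _ _]mxE.
  congr (_ * _).
    by rewrite mxE eqxx.
  rewrite /cofactor; congr (_ * \det _); apply/matrixP => k l.
  by rewrite !mxE eq_sym (negPf (neq_lift _ _)) mxE.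
have LX' k : row k X' \in L by rewrite rowK; case: eqP.
have X0 : \det X != 0 by rewrite -unitfE -unitmxE.
have [N' NE'] := index X' LX'.
have /Nmin : P N'.
  apply/asboolP; exists X'; split=> //.
  by rewrite unitmxE unitfE detX' mulf_neq0.
apply/negP; rewrite -ltnNge -(ltr_nat R) -(@ltr_pM2r _ `|\det V|) ?normr_gt0 //.
rewrite -NE -NE' ltr_pM2l ?exprn_gt0 ?ltr0n // detX' normrM.
by rewrite -{2}[`|\det X|]mul1r ltr_pM2r ?normr_gt0 // ger0_norm.
Qed.
End EuclideanLattices.

(** * The cross product *)

Lemma ord3P (i : 'I_3) : [\/ i = 0, i = 1 | i = 2].
Proof.
case: i => [[|[|[|//]]] p]; [apply: Or31|apply: Or32|apply: Or33];
  exact/val_inj.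
Qed.

Lemma sum_ord3 (V : nmodType) (F : 'I_3 -> V) : \sum_i F i = F 0 + F 1 + F 2.
Proof.
rewrite !big_ord_recl big_ord0 addr0 addrA.
by congr (_ + F _ + F _); apply/val_inj.
Qed.

Lemma add3_11 : 1 + 1 = 2 :> 'I_3. Proof. exact/val_inj. Qed.
Lemma add3_12 : 1 + 2 = 0 :> 'I_3. Proof. exact/val_inj. Qed.
Lemma add3_21 : 2 + 1 = 0 :> 'I_3. Proof. exact/val_inj. Qed.
Lemma add3_22 : 2 + 2 = 1 :> 'I_3. Proof. exact/val_inj. Qed.
Definition add3 := (@add0r 'I_3, add3_11, add3_12, add3_21, add3_22).

Section CrossProduct.
Variable K : comNzRingType.
Implicit Types (u v : 'rV[K]_3) (A B M : 'M[K]_3).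

(* Addition in 'I_3 is cyclic, so [circ y y'] is the group cocycle
   (y2 y3', y3 y1', y1 y2'), and [cofmx B] is the cofactor matrix of [B]. *)
Definition circ u v : 'rV[K]_3 := \row_i (u 0 (i + 1) * v 0 (i + 2)).
Definition cross u v : 'rV[K]_3 := circ u v - circ v u.
Definition cofmx B : 'M[K]_3 := \matrix_i cross (row (i + 1) B) (row (i + 2) B).

Lemma circ0 u : circ u 0 = 0.
Proof. by apply/rowP => i; rewrite !mxE mulr0. Qed.

Lemma circ0l u : circ 0 u = 0.
Proof. by apply/rowP => i; rewrite !mxE mul0r. Qed.

Lemma circDl u v w : circ (u + v) w = circ u w + circ v w.
Proof. by apply/rowP => i; rewrite !mxE mulrDl. Qed.

Lemma circDr u v w : circ w (u + v) = circ w u + circ w v.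
Proof. by apply/rowP => i; rewrite !mxE mulrDr. Qed.

(** Functoriality of the second exterior power: a change of basis acts on commutators through the
    cofactor matrix. *)
Lemma cross_mulmx u v B : cross (u *m B) (v *m B) = cross u v *m cofmx B.
Proof.
apply/rowP => j; rewrite [RHS]mxE sum_ord3 !mxE !sum_ord3.
by case: (ord3P j) => ->; rewrite !add3; ring.
Qed.

Lemma cofmxM A B : cofmx (A *m B) = cofmx A *m cofmx B.
Proof.
by apply/row_matrixP => i; rewrite row_mul !rowK !row_mul cross_mulmx.
Qed.

Lemma cofmx1 : cofmx 1%:M = 1%:M.
Proof.
apply/matrixP => i j; rewrite !mxE.
by case: (ord3P i) => ->; case: (ord3P j) => ->; rewrite !add3 /=; ring.
Qed.

(** The scalar is the triple product of the rows, that is, the determinant of [M]. *)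
Lemma cofmx_mul_tr M : exists s, cofmx M *m M^T = s%:M.
Proof.
exists ((cross (row 1 M) (row 2 M) *m (row 0 M)^T) 0 0).
apply/matrixP => i j; rewrite !mxE !sum_ord3 !mxE.
by case: (ord3P i) => ->; case: (ord3P j) => ->; rewrite !add3 /=; ring.
Qed.
End CrossProduct.

Lemma cofmx_unit (K : comUnitRingType) (B : 'M[K]_3) :
  B \in unitmx -> cofmx B \in unitmx.
Proof.
move=> Bu; suff /mulmx1_unit[] : cofmx B *m cofmx (invmx B) = 1%:M by [].
by rewrite -cofmxM mulmxV // cofmx1.
Qed.

Lemma map_circ (K K' : comNzRingType) (f : {rmorphism K -> K'})
    (u v : 'rV[K]_3) :
  map_mx f (circ u v) = circ (map_mx f u) (map_mx f v).
Proof. by apply/rowP => i; rewrite !mxE rmorphM. Qed.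

Lemma map_cofmx (K K' : comNzRingType) (f : {rmorphism K -> K'}) (B : 'M[K]_3) :
  map_mx f (cofmx B) = cofmx (map_mx f B).
Proof. by apply/matrixP => i j; rewrite !mxE rmorphB !rmorphM. Qed.

Definition diag3 (K : pzSemiRingType) (d1 d2 d3 : nat) : 'M[K]_3 :=
  diag_mx (\row_i [:: d1%:R; d2%:R; d3%:R]`_i).

Lemma map_diag3 (K K' : nzRingType) (f : {rmorphism K -> K'}) d1 d2 d3 :
  map_mx f (diag3 K d1 d2 d3) = diag3 K' d1 d2 d3.
Proof.
rewrite map_diag_mx; congr diag_mx; apply/rowP => i; rewrite !mxE.
by case: (ord3P i) => ->; rewrite /= rmorph_nat.
Qed.

(** * Lattices of the cotangent Heisenberg group *)

Section Group.
Variable R : realType.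
Local Notation G := (cotangent_heisenberg R).
Implicit Types (x y : 'rV[R]_3).

Definition mkG x y : G := (x 0 0, x 0 1, x 0 2, y 0 0, y 0 1, y 0 2).

Lemma mkG_surj (g : G) : exists x y, g = mkG x y.
Proof.
case: g => [[[[[x0 x1] x2] y0] y1] y2].
exists (\row_i [:: x0; x1; x2]`_i), (\row_i [:: y0; y1; y2]`_i).
by rewrite /mkG !mxE.
Qed.

Lemma mkG_inj x y x' y' : mkG x y = mkG x' y' -> x = x' /\ y = y'.
Proof.
case=> x0 x1 x2 y0 y1 y2.
by split; apply/rowP => i; case: (ord3P i) => ->.
Qed.

Lemma mkGM x y x' y' :
  (mkG x y * mkG x' y')%g = mkG (x + x' + circ y y') (y + y').
Proof. by rewrite /mkG !mxE !add3. Qed.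

Lemma mkG1 : 1%g = mkG 0 0.
Proof. by rewrite /mkG !mxE. Qed.

Lemma mkGV x y : ((mkG x y)^-1)%g = mkG (- x + circ y y) (- y).
Proof. by rewrite /mkG !mxE !add3. Qed.

Lemma comm_mkG x y x' y' :
  (mkG x y * mkG x' y' * (mkG x' y' * mkG x y)^-1)%g = mkG (cross y y') 0.
Proof.
rewrite !mkGM mkGV mkGM; congr mkG; apply/rowP => i; rewrite !mxE ?add3; ring.
Qed.

Variable Gam : groupClosed G.

Lemma open_near_coord (p : G -> R) (c r : R) : continuous p ->
  open [set g : G | `|p g + c| < r]%classic.
Proof.
move=> cp.
have -> : [set g : G | `|p g + c| < r]%classic = (p @^-1` ball (- c) r)%classic.
  by apply/seteqP; split=> g /=; rewrite /ball /= -opprD normrN addrC.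
by apply: open_comp => [g _|]; [exact: cp | exact: ball_open].
Qed.

Lemma open_near_proj (y : 'rV[R]_3) (r : R) :
  open [set g : G | exists x' y', g = mkG x' y' /\
                    forall i, `|(y' + y) 0 i| < r]%classic.
Proof.
pose p0 (g : G) : R := g.1.1.2.
pose p1 (g : G) : R := g.1.2.
pose p2 (g : G) : R := g.2.
have cfst (U V : topologicalType) : continuous (@fst U V).
  by move=> ?; exact: cvg_fst.
have csnd (U V : topologicalType) : continuous (@snd U V).
  by move=> ?; exact: cvg_snd.
have c2 : continuous p2 by exact: csnd.
have c1 : continuous p1.
  move=> g; apply: (@continuous_comp _ _ _ fst snd); last exact: csnd.
  exact: cfst.
have c0 : continuous p0.
  move=> g; apply: (@continuous_comp _ _ _ (fst \o fst) snd); last exact: csnd.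
  by apply: (@continuous_comp _ _ _ fst fst); exact: cfst.
have := openI (@open_near_coord _ (y 0 2) r c2) (openI
  (@open_near_coord _ (y 0 0) r c0) (@open_near_coord _ (y 0 1) r c1)).
congr open; apply/seteqP; split=> g /=.
  have [a [b ->]] := mkG_surj g => -[b2 [b0 b1]].
  exists a, b; split=> // i.
  by case: (ord3P i) => ->; rewrite mxE.
by move=> [a [b [-> h]]]; move: (h 0) (h 1) (h 2); rewrite !mxE.
Qed.

(** The cosets with a representative whose [y] part is bounded by [M] form open sets that increase
    with [M] and cover the quotient; by compactness a single [M] suffices. *)
Lemma cocompact_bounded : cocompact_subgroup Gam -> exists M, forall y,
  exists x' y', mkG x' y' \in Gam /\ forall i, `|(y - y') 0 i| < M.
Proof.
rewrite /cocompact_subgroup compact_near_coveringP => cpt.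
set Q : topologicalType := quotient_topology (lcoset_space Gam).
pose P (M : R) (q : Q) := exists x y,
  q = (\pi_(lcoset_space Gam) (mkG x y))%qT /\
  forall i, `|y 0 i| < M.
have piP (g g' : G) : ((\pi g : lcoset_space Gam) = \pi g')%qT <->
    (g^-1 * g')%g \in Gam.
  by split=> [/eqquotP|h]; last apply/eqquotP.
have /filter_ex[M MP] : \forall M \near +oo, ([set: Q] `<=` P M)%classic.
  apply: cpt => q _.
  have [x [y qE]] := mkG_surj (repr q).
  pose M : R := 1 + \sum_i `|y 0 i|.
  exists (P M, [set M' | M < M']%classic) => /=; last first.
    move=> [q' M'] /= [[x' [y' [E yM]]] MM']; exists x', y'; split=> // i.
    exact: lt_trans MM'.
  split; last by apply: nbhs_pinfty_gt; exact: num_real.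
  apply: (@open_nbhs_nbhs Q q); split; last first.
    exists x, y; split=> [|i]; first by rewrite -qE reprK.
    by rewrite /M (bigD1 i) //= addrCA ltrDl ltr_pwDl // sumr_ge0.
  (* [P M] is the image of a box; its preimage is the union of the right
     translates of the box by [Gam]. *)
  rewrite /open /= /quotient_open.
  have -> : (\pi_(lcoset_space Gam)%qT @^-1` P M)%classic =
    (\bigcup_(ab in [set ab : 'rV[R]_3 * 'rV[R]_3 | mkG ab.1 ab.2 \in Gam])
      [set g : G | exists x' y', g = mkG x' y' /\
                    forall i, `|(y' + ab.2) 0 i| < M])%classic.
    apply/seteqP; split=> g /=.
      move=> [x1 [y1 [/piP E y1M]]]; have [x2 [y2 gE]] := mkG_surj g.
      move: E; rewrite gE mkGV mkGM => E; eexists (_, _); first exact: E.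
      by exists x2, y2; split=> // i; rewrite /= addNKr.
    move=> [[a b]] /= ab [x1 [y1 [-> yM]]].
    exists (x1 + a + circ y1 b), (y1 + b); split=> //; apply/piP.
    by rewrite -mkGM mulKg.
  by apply: bigcup_open => ab _; exact: open_near_proj.
(* The coset of [mkG 0 y] has a representative with small projection [y']; the two differ by an
   element of [Gam] projecting to [y - y']. *)
exists M => y.
have [x' [y' [/piP E yM]]] := MP (\pi_(lcoset_space Gam) (mkG 0 y))%qT I.
move: E; rewrite -gpredV invgM invgK mkGV mkGM => E.
eexists _, _; split; first exact: E.
by move=> i; rewrite opprD opprK addrC subrK.
Qed.
End Group.

Lemma group_iso_image (G H : groupType) (S : groupClosed G) (phi : H -> G) :
  {morph phi : h k / (h * k)%g} -> injective phi ->
  (forall g, g \in S <-> exists h, phi h = g) -> group_iso (subgroup_type S) H.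
Proof.
move=> phiM phiI phiS.
have /choice[F FP] (u : subgroup_type S) : exists h, phi h = val u.
  by apply/phiS; exact: (valP u).
have FM : {morph F : u v / (u * v)%g}.
  by move=> u v; apply: phiI; rewrite phiM !FP gmulfM.
pose f : {multiplicative subgroup_type S -> H} :=
  HB.pack F (isMultiplicative.Build _ _ F FM).
have inS h : phi h \in S by apply/phiS; exists h.
exists f; exists (fun h => Sub (phi h) (inS h) : subgroup_type S) => [u|h].
  by apply/val_inj; rewrite SubK FP.
by apply: phiI; rewrite FP SubK.
Qed.

(** Vectors of [L] close to large multiples of the standard vectors form a matrix close to a large
    scalar matrix, hence with trivial kernel. *)
Lemma cobounded_basis (R : realFieldType) n (L : pred 'rV[R]_n) (M : R) :
  (forall v, exists2 w, w \in L & forall i, `|(v - w) 0 i| < M) ->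
  exists2 V : 'M[R]_n, V \in unitmx & forall i, row i V \in L.
Proof.
(* Summing the bounds [uN] over [j] gives N S <= n |M| S for the sum S of the [|u 0 j|]; this [N]
   forces S <= 0. *)
move=> cob; pose N := `|M| * n%:R + 1.
have N0 : 0 <= N by rewrite addr_ge0 ?mulr_ge0.
have /choice[w wP] j : exists w, w \in L /\
    forall i, `|(N *: delta_mx 0 j - w) 0 i| < M.
  by have [w] := cob (N *: delta_mx 0 j); exists w.
exists (\matrix_j w j); last by move=> i; rewrite rowK; have [] := wP i.
rewrite -row_free_unit -kermx_eq0; apply/rowV0P => u /sub_kermxP uV.
have uN j : `|u 0 j| * N <= \sum_i `|u 0 i| * `|M|.
  rewrite -{1}(ger0_norm N0) -normrM.
  have -> : u 0 j * N = \sum_i u 0 i * (N *: delta_mx 0 i - w i) 0 j.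
    transitivity (\sum_i u 0 i * (N *: delta_mx 0 i : 'rV_n) 0 j -
                  (u *m \matrix_j w j) 0 j).
      rewrite uV [X in _ - X]mxE subr0 (bigD1 j) //= big1 ?addr0 => [|i ij].
        by rewrite !mxE !eqxx mulr1.
      by rewrite !mxE eq_sym (negPf ij) andbF !mulr0.
    rewrite [X in _ - X]mxE -sumrB; apply: eq_bigr => i _.
    by rewrite -mulrBr !mxE.
  apply: le_trans (ler_norm_sum _ _ _) _; apply: ler_sum => i _.
  rewrite normrM ler_wpM2l // ltW // (lt_le_trans _ (ler_norm M)) //.
  by have [] := wP i.
have : \sum_j `|u 0 j| <= 0.
  have : \sum_j `|u 0 j| * N <= \sum_(j < n) \sum_i `|u 0 i| * `|M|.
    by apply: ler_sum => j _; exact: uN.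
  rewrite sumr_const card_ord -mulr_suml -mulr_suml -mulr_natr /N.
  by rewrite -/(\sum_j _) mulrDr mulr1 mulrA gerDl.
move=> S0; apply/rowP => j; rewrite mxE; apply/eqP; rewrite -normr_le0.
by apply: le_trans S0; rewrite (bigD1 j) //= lerDl sumr_ge0.
Qed.

Definition zbasis (R : comUnitRingType) n (L : pred 'rV[R]_n) (B : 'M[R]_n) :=
  B \in unitmx /\
  forall v, v \in L <-> exists z : 'rV[int]_n, v = map_mx intr z *m B.

Lemma zbasis_mul (R : comUnitRingType) n (L : pred 'rV[R]_n) B (U : 'M[int]_n) :
  U \in unitmx -> zbasis L B -> zbasis L (map_mx intr U *m B).
Proof.
move=> Uu [Bu LB]; split=> [|v].
  by rewrite unitmx_mul Bu andbT unitmxE det_map_mx rmorph_unit.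
split=> [/LB[z ->]|[z ->]].
  by exists (z *m invmx U); rewrite mulmxA -map_mxM mulmxKV.
by apply/LB; exists (z *m U); rewrite map_mxM mulmxA.
Qed.

Lemma row_zbasis (R : comUnitRingType) n (L : pred 'rV[R]_n) B i :
  zbasis L B -> row i B \in L.
Proof.
by move=> [_ LB]; apply/LB; exists (delta_mx 0 i); rewrite map_delta_mx -rowE.
Qed.

(** * Integral bases of the centre and of the projection *)

Section Lattice.
Variable R : realType.
Local Notation G := (cotangent_heisenberg R).
Variable Gam : groupClosed G.

Definition center_part : pred 'rV[R]_3 := fun x => mkG x 0 \in Gam.
Definition proj_part : pred 'rV[R]_3 :=
  fun y => `[< exists x, mkG x y \in Gam >].

Lemma center_part_closed : zmod_closed center_part.
Proof.
split=> [|x x' xL x'L]; rewrite unfold_in /center_part.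
  by rewrite -mkG1 gpred1.
have := gpredF (xL : mkG x 0 \in Gam) (x'L : mkG x' 0 \in Gam).
by rewrite mkGV mkGM !circ0 oppr0 !circ0 !addr0.
Qed.

HB.instance Definition _ :=
  GRing.isZmodClosed.Build _ center_part center_part_closed.

Lemma discrete_center : discrete_subgroup Gam -> exists2 e : R, 0 < e &
  forall x, x \in center_part -> (forall i, `|x 0 i| < e) -> x = 0.
Proof.
move=> /(_ 1%g); rewrite /= gpred1 => /(_ isT)[_ [V V1 VG]].
have : nbhs ((0, 0, 0, 0, 0, 0) : R * R * R * R * R * R) V by exact: V1.
move=> /nbhs_ballP[e /= e0 eV]; exists e => // x Gx xe.
suff : ([set 1%g] : set G)%classic (mkG x 0) by rewrite /= mkG1 => /mkG_inj[].
rewrite -VG; split=> //; apply: eV.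
do ![split] => /=; rewrite ?mxE /ball /= ?sub0r ?normrN ?subrr ?normr0 //.
Qed.

Lemma proj_part_closed : zmod_closed proj_part.
Proof.
split=> [|y y' /asboolP[x xy] /asboolP[x' xy']]; apply/asboolP.
  by exists 0; rewrite -mkG1 gpred1.
by have := gpredF xy xy'; rewrite mkGV mkGM; eexists; eassumption.
Qed.

HB.instance Definition _ :=
  GRing.isZmodClosed.Build _ proj_part proj_part_closed.

Lemma cross_center y y' :
  y \in proj_part -> y' \in proj_part -> cross y y' \in center_part.
Proof.
move=> /asboolP[x xy] /asboolP[x' xy'].
by rewrite unfold_in /center_part -(comm_mkG x y x' y') gpredM ?gpredV ?gpredM.
Qed.

Lemma cofmx_center (B : 'M[R]_3) : (forall i, row i B \in proj_part) ->
  forall i, row i (cofmx B) \in center_part.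
Proof. by move=> BL i; rewrite rowK cross_center. Qed.

Hypothesis latG : lattice Gam.

Lemma proj_part_rows :
  exists2 V : 'M[R]_3, V \in unitmx & forall i, row i V \in proj_part.
Proof.
have [_ /cocompact_bounded[M MP]] := latG.
apply: (@cobounded_basis _ _ _ M) => v; have [x [y [xy yM]]] := MP v.
by exists y => //; apply/asboolP; exists x.
Qed.

Lemma center_part_zbasis : exists E, zbasis center_part E.
Proof.
have [V Vu VL] := proj_part_rows; have [/discrete_center dis _] := latG.
have [E Eu EL] := lattice_basis dis (cofmx_center VL) (cofmx_unit Vu).
by exists E.
Qed.

Lemma proj_part_discrete : exists2 e : R, 0 < e &
  forall v, v \in proj_part -> (forall i, `|v 0 i| < e) -> v = 0.
Proof.
have [V Vu VL] := proj_part_rows.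
have [/discrete_center[e e0 dis] _] := latG.
pose K := 1 + \sum_i \sum_j `|V i j|.
have VK i j : `|V i j| <= K.
  rewrite /K (bigD1 i) //= (bigD1 j) //= addrCA -addrA lerDl !addr_ge0 //.
    by rewrite sumr_ge0.
  by rewrite sumr_ge0 // => k _; rewrite sumr_ge0.
have K0 : 0 < K by rewrite ltr_pwDl // sumr_ge0 // => i _; rewrite sumr_ge0.
(* Each coordinate of [cross y (row i V)] is a difference of two products, each below e/2. *)
exists (e / (2 * K)) => [|y yL ye]; first by rewrite divr_gt0 ?mulr_gt0.
have crossV i : cross y (row i V) = 0.
  apply: dis => [|k]; first exact: cross_center.
  rewrite !mxE (le_lt_trans (ler_normB _ _)) //.
  have H a b : `|y 0 a * V i b| < e / 2.
    rewrite normrM (@le_lt_trans _ _ (`|y 0 a| * K)) ?ler_wpM2l //.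
    by rewrite -ltr_pdivlMr // -mulrA -invfM.
  by rewrite [e]splitr ltrD // mulrC.
(* [S] is the matrix of the map taking v to [cross y v]. It vanishes on the basis [V], and its entry
   (i + 1, i + 2) is [y 0 i]. *)
pose S : 'M[R]_3 := \matrix_i cross y (delta_mx 0 i).
have crossE v : cross y v = v *m S.
  apply/rowP => j; rewrite [RHS]mxE sum_ord3 !mxE.
  by case: (ord3P j) => ->; rewrite !add3 /=; ring.
have S0 : S = 0.
  rewrite -(mulKmx Vu S) (_ : V *m S = 0) ?mulmx0 //.
  by apply/row_matrixP => i; rewrite row_mul -crossE crossV row0.
apply/rowP => i; have := congr1 (fun A : 'M[R]_3 => A (i + 1) (i + 2)) S0.
rewrite !mxE; case: (ord3P i) => ->; rewrite !add3 /= => E;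
  by rewrite -[RHS]E; ring.
Qed.

Lemma proj_part_zbasis : exists B, zbasis proj_part B.
Proof.
have [V Vu VL] := proj_part_rows.
by have [B Bu BL] := lattice_basis proj_part_discrete VL Vu; exists B.
Qed.

Lemma adapted_zbases : exists B E (d1 d2 d3 : nat),
  [/\ zbasis proj_part B, zbasis center_part E,
      [/\ (0 < d1)%N, (0 < d2)%N & (0 < d3)%N], (d1 %| d2)%N /\ (d2 %| d3)%N &
      cofmx B = diag3 R d1 d2 d3 *m E].
Proof.
have [B Bz] := proj_part_zbasis; have [E Ez] := center_part_zbasis.
have /choice[c cE] i :
    exists z : 'rV[int]_3, row i (cofmx B) = map_mx intr z *m E.
  have [_ EL] := Ez; apply/EL; apply: cofmx_center => k; exact: row_zbasis Bz.
pose C : 'M[int]_3 := \matrix_i c i.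
have CE : cofmx B = map_mx intr C *m E.
  by apply/row_matrixP => i; rewrite cE row_mul -map_row rowK.
have [L Lu [U Uu [d dsort CLU]]] := int_Smith_normal_form C.
pose D : 'M[int]_3 := diag_mx (\row_i d`_i).
have {}CLU : C = L *m D *m U.
  by rewrite CLU; congr (_ *m _ *m _); apply/matrixP => i j; rewrite !mxE.
have Ltu : L^T \in unitmx by rewrite unitmx_tr.
(* Here [cofmx L^T *m L] is the scalar [s], a unit because both factors are invertible; it cancels
   the left Smith factor. *)
have [s sE] := cofmx_mul_tr L^T; rewrite trmxK in sE.
have su : s%:M \in @unitmx int 3 by rewrite -sE unitmx_mul cofmx_unit.
(* The Smith divisors may be negative; their signs are moved into the basis of the centre. *)
pose Sg : 'M[int]_3 := diag_mx (\row_i (-1) ^+ (d`_i < 0)%R).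
have Sgu : Sg \in unitmx.
  suff /mulmx1_unit[] : Sg *m Sg = 1%:M by [].
  rewrite mulmx_diag; apply/matrixP => i j; rewrite !mxE.
  by rewrite -signr_addb addbb.
pose B' := map_mx intr L^T *m B; pose E' := map_mx intr (Sg *m s%:M *m U) *m E.
have Bz' : zbasis proj_part B' by exact: zbasis_mul.
have Ez' : zbasis center_part E'.
  by apply: zbasis_mul => //; rewrite !unitmx_mul Sgu su.
have cofB' : cofmx B' = map_mx intr (D *m s%:M *m U) *m E.
  rewrite /B' cofmxM -map_cofmx CE mulmxA -map_mxM CLU.
  by rewrite -mulmxA !mulmxA sE !mul_scalar_mx mul_mx_scalar.
(* [cofmx B'] is invertible since [B'] is a basis, so no Smith divisor is zero. *)
have Du : map_mx intr D \in @unitmx R 3.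
  have := cofmx_unit Bz'.1.
  by rewrite cofB' !map_mxM !unitmx_mul -!andbA => /andP[].
have d0 (i : 'I_3) : d`_i != 0.
  move: Du; rewrite unitmxE det_map_mx det_diag unitfE intr_eq0.
  rewrite prodf_seq_neq0 => /allP/(_ i).
  by rewrite mem_index_enum mxE => /(_ isT).
pose a i := absz d`_i.
have dpos (i : 'I_3) : (0 < a i)%N by rewrite absz_gt0.
have dvd i : (i < 2)%N -> (a i %| a i.+1)%N.
  move=> i2; have := d0 (inord i.+1); rewrite inordK // => di.
  (* The list [d] may a priori be shorter than three; a missing entry would read as the default 0,
     excluded by [d0]. *)
  case: (ltnP i.+1 (size d)) => [lt|le].
    exact: (elimT (sortedP 0) dsort i lt).
  by rewrite nth_default ?eqxx in di.
exists B', E', (a 0%N), (a 1%N), (a 2%N); split=> //.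
- by split; [exact: (dpos 0) | exact: (dpos 1) | exact: (dpos 2)].
- by split; apply: dvd.
rewrite cofB' /E' mulmxA; congr (_ *m _); rewrite -!mulmxA !map_mxM !mulmxA.
congr (_ *m _ *m _); rewrite !map_diag_mx mulmx_diag; congr diag_mx.
apply/rowP => i; rewrite !mxE [in LHS](intEsign d`_i) rmorphM mulrC /=.
by congr (_ * _); case: (ord3P i) => ->.
Qed.
End Lattice.

(** * Lattices are isomorphic to models *)

Section Model.
Variables d1 d2 d3 : nat.
Local Notation L := (lattice_model d1 d2 d3).

Definition mkL (a b : 'rV[int]_3) : L :=
  (a 0 0, a 0 1, a 0 2, b 0 0, b 0 1, b 0 2).

Lemma mkL_surj (g : L) : exists a b, g = mkL a b.
Proof.
case: g => [[[[[x0 x1] x2] y0] y1] y2].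
exists (\row_i [:: x0; x1; x2]`_i), (\row_i [:: y0; y1; y2]`_i).
by rewrite /mkL !mxE.
Qed.

Lemma mkL_inj a b a' b' : mkL a b = mkL a' b' -> a = a' /\ b = b'.
Proof.
case=> x0 x1 x2 y0 y1 y2.
by split; apply/rowP => i; case: (ord3P i) => ->.
Qed.

Lemma mkLM a b a' b' :
  (mkL a b * mkL a' b')%g =
  mkL (a + a' + circ b b' *m diag3 int d1 d2 d3) (b + b').
Proof.
rewrite /mkL mul_mx_diag !mxE !add3 /=; congr (_, _, _, _, _, _);
  by rewrite /= ?natz //; ring.
Qed.

Lemma mkL1 : 1%g = mkL 0 0.
Proof. by rewrite /mkL !mxE. Qed.
End Model.

Section Parametrization.
Variables (R : realType) (d1 d2 d3 : nat) (B E A : 'M[R]_3).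
Hypothesis cofB : cofmx B = diag3 R d1 d2 d3 *m E.
Implicit Types a b : 'rV[R]_3.

Let D := diag3 R d1 d2 d3.

(* [paramM] makes [param] a homomorphism from the model scaled to R as soon as
   the bilinear form [defect], symmetric by [cofB], is the polarization of
   [quad]; the linear term [A] is free and serves to hit prescribed lifts of the
   rows of [B]. *)
Definition defect b b' := circ (b *m B) (b' *m B) - circ b b' *m D *m E.
Definition quad b := 2^-1 *: defect b b + b *m A.
Definition param a b := mkG (a *m E + quad b) (b *m B).

Lemma defect_sym b b' : defect b b' = defect b' b.
Proof.
have := cross_mulmx b b' B; rewrite cofB mulmxA /cross !mulmxBl => H.
rewrite /defect -[circ (b *m B) _](subrK (circ (b' *m B) (b *m B))) H.
by rewrite addrC !addrA addNr add0r addrC.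
Qed.

Lemma quadD b b' : quad (b + b') = quad b + quad b' + defect b b'.
Proof.
have -> : quad (b + b') = b *m A + b' *m A +
    2^-1 *: (defect b b + defect b' b' + defect b b' + defect b' b).
  rewrite /quad mulmxDl addrC; congr (_ + _ *: _).
  rewrite /defect !mulmxDl !circDl !circDr !mulmxDl.
  by apply/rowP => i; rewrite !mxE; ring.
rewrite -(defect_sym b b') /quad; apply/rowP => i; rewrite !mxE.
by field.
Qed.

Lemma paramM a b a' b' : (param a b * param a' b')%g =
  param (a + a' + circ b b' *m D) (b + b').
Proof.
rewrite mkGM -mulmxDl /param; congr mkG; rewrite quadD /defect !mulmxDl.
by apply/rowP => i; rewrite !mxE; ring.
Qed.

Lemma quad0 : quad 0 = 0.
Proof. by rewrite /quad /defect !mul0mx !circ0 !mul0mx subr0 addr0 scaler0. Qed.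

End Parametrization.

(** The parametrization restricted to integer vectors embeds the model in the group. Its image lies
    in [Gam] because the generators do, and it is all of [Gam] because an element of [Gam] is
    determined up to the centre by its projection. *)
Lemma lattice_iso_model (R : realType)
    (Gam : groupClosed (cotangent_heisenberg R)) (B E : 'M[R]_3) d1 d2 d3 :
  zbasis (proj_part Gam) B -> zbasis (center_part Gam) E ->
  cofmx B = diag3 R d1 d2 d3 *m E ->
  group_iso (subgroup_type Gam) (lattice_model d1 d2 d3).
Proof.
move=> Bz Ez cofB.
have /choice[x xP] i : exists x, mkG x (row i B) \in Gam.
  by apply/asboolP; exact: (row_zbasis i Bz).
have [Bu BL] := Bz; have [Eu EL] := Ez.
(* Cancels the quadratic term at the standard vectors, so that [psi 0 (delta_mx 0 i)] is the chosen
   lift [mkG (x i) (row i B)]. *)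
pose A : 'M[R]_3 := \matrix_i
  (x i - 2^-1 *: defect d1 d2 d3 B E (delta_mx 0 i) (delta_mx 0 i)).
pose psi (a b : 'rV[int]_3) :=
  param d1 d2 d3 B E A (map_mx intr a) (map_mx intr b).
have psiM a b a' b' : (psi a b * psi a' b')%g =
    psi (a + a' + circ b b' *m diag3 int d1 d2 d3) (b + b').
  by rewrite /psi paramM // !map_mxD map_mxM map_circ map_diag3.
have psi_inj a b a' b' : psi a b = psi a' b' -> a = a' /\ b = b'.
  have intr_inj (u v : 'rV[int]_3) :
      map_mx intr u = map_mx intr v :> 'rV[R]_3 -> u = v.
    move=> /rowP uv; apply/rowP => i.
    by have := uv i; rewrite !mxE => /intr_inj.
  move=> /mkG_inj[+ /(can_inj (mulmxK Bu))/intr_inj bb'].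
  by rewrite bb' => /addIr /(can_inj (mulmxK Eu))/intr_inj ->.
have psi_center a : psi a 0 \in Gam.
  rewrite /psi /param map_mx0 quad0 mul0mx addr0.
  by apply: (EL _).2; exists a.
have psi_e i : psi 0 (delta_mx 0 i) \in Gam.
  rewrite /psi /param map_mx0 mul0mx add0r /quad map_delta_mx -!rowE rowK.
  by rewrite addrC subrK.
have psi_split a b : psi a b = (psi a 0 * psi 0 b)%g.
  by rewrite psiM add0r addr0 circ0l mul0mx addr0.
have psi0 b : psi 0 b \in Gam.
  elim/int_rV_ind: b => [|b b' bL b'L|//]; first exact: psi_center.
  (* Multiplying [psi 0 (b - b')] by [psi 0 b'] gives [psi 0 b] up to a central factor already in
     [Gam]. *)
  by rewrite -(gpredMr _ b'L) psiM subrK psi_split gpredM.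
have psiL a b : psi a b \in Gam by rewrite psi_split gpredM.
pose phi (g : lattice_model d1 d2 d3) : cotangent_heisenberg R :=
  let: (a1, a2, a3, b1, b2, b3) := g in
  psi (\row_i [:: a1; a2; a3]`_i) (\row_i [:: b1; b2; b3]`_i).
have phiE a b : phi (mkL _ _ _ a b) = psi a b.
  by congr psi; apply/rowP => i; rewrite mxE; case: (ord3P i) => ->.
apply: (@group_iso_image _ _ _ phi).
- move=> g g'; have [a [b ->]] := mkL_surj g; have [a' [b' ->]] := mkL_surj g'.
  by rewrite mkLM !phiE psiM.
- move=> g g'; have [a [b ->]] := mkL_surj g; have [a' [b' ->]] := mkL_surj g'.
  by rewrite !phiE => /psi_inj[-> ->].
move=> g; split=> [gL|[h <-]]; last first.
  by have [a [b ->]] := mkL_surj h; rewrite phiE.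
have [u [y gE]] := mkG_surj g; rewrite gE in gL.
have /BL[b yE] : y \in proj_part Gam by apply/asboolP; exists u.
(* Dividing by [psi 0 b], which has the same projection, leaves a central element; its coordinates
   in [E] give [a]. *)
have := gpredF gL (psi0 b).
have -> : (mkG u y * (psi 0 b)^-1)%g =
    mkG (u + (- (0 *m E + quad d1 d2 d3 B E A (map_mx intr b)) + circ y y)
         - circ y y) 0.
  rewrite /psi /param mkGV mkGM map_mx0 -yE subrr; congr mkG.
  by apply/rowP => i; rewrite !mxE; ring.
move=> /EL[a aE]; exists (mkL _ _ _ a b).
rewrite phiE gE /psi /param -yE -aE mul0mx add0r; congr mkG.
by apply/rowP => i; rewrite !mxE; ring.
Qed.

(** * Models with different parameters are not isomorphic *)

(** The commutator, written without inverses so that it transports directly along a homomorphism. *)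
Lemma mkL_comm d1 d2 d3 a b a' b' :
  (mkL d1 d2 d3 a b * mkL d1 d2 d3 a' b')%g =
  (mkL d1 d2 d3 (cross b b' *m diag3 int d1 d2 d3) 0 *
   (mkL d1 d2 d3 a' b' * mkL d1 d2 d3 a b))%g.
Proof.
rewrite !mkLM add0r (addrC b b') circ0l mul0mx addr0.
congr mkL; rewrite /cross mulmxBl; apply/rowP => i; rewrite !mxE; ring.
Qed.

Lemma model_center d1 d2 d3 a b :
  [/\ (0 < d1)%N, (0 < d2)%N & (0 < d3)%N] ->
  (forall g, (mkL d1 d2 d3 a b * g)%g = (g * mkL d1 d2 d3 a b)%g) <-> b = 0.
Proof.
move=> [d1p d2p d3p]; split=> [C|-> g].
  have H c : cross b c *m diag3 int d1 d2 d3 = 0.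
    have := C (mkL _ _ _ 0 c); rewrite mkL_comm !mkLM => /mkL_inj[+ _].
    rewrite circ0l mul0mx addr0.
    by rewrite -[X in _ = X]add0r => /addIr.
  apply/rowP => i; rewrite [RHS]mxE.
  (* Coordinate i + 2 of the cross product of [b] with this standard vector is [b 0 i]; the diagonal
     factor is nonzero. *)
  have /rowP/(_ (i + 2)) := H (delta_mx 0 (i + 1)).
  rewrite mul_mx_diag !mxE.
  have np n : (0 < n)%N -> (n%:R : int) != 0 by rewrite natz -lt0n.
  case: (ord3P i) => ->; rewrite !add3 /= => /eqP;
  rewrite mulf_eq0 !(negPf (np _ _)) // orbF => /eqP E;
  by rewrite -[RHS]E; ring.
have [a' [b' ->]] := mkL_surj g; rewrite mkL_comm.
by rewrite /cross circ0l circ0 subrr mul0mx -mkL1 mul1g.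
Qed.

(** An isomorphism maps centre to centre, and an additive map of Z^3 is a matrix. *)
Lemma model_hom_matrix d1 d2 d3 e1 e2 e3
    (h : lattice_model d1 d2 d3 -> lattice_model e1 e2 e3) k :
  [/\ (0 < d1)%N, (0 < d2)%N & (0 < d3)%N] ->
  [/\ (0 < e1)%N, (0 < e2)%N & (0 < e3)%N] ->
  {morph h : x y / (x * y)%g} -> cancel h k -> cancel k h ->
  exists A : 'M[int]_3, forall a, h (mkL _ _ _ a 0) = mkL _ _ _ (a *m A) 0.
Proof.
move=> dp ep hM hK kH.
have hc a : exists w, h (mkL _ _ _ a 0) = mkL _ _ _ w 0.
  have [w [b E]] := mkL_surj (h (mkL _ _ _ a 0)); exists w.
  rewrite E; congr mkL; apply/(model_center w b ep) => g.
  rewrite -E -(kH g) -!hM; congr h.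
  exact: ((model_center a 0 dp).2 erefl).
have /choice[c cP] i := hc (delta_mx 0 i).
have addL f1 f2 f3 a b :
    (mkL f1 f2 f3 a 0 * mkL f1 f2 f3 b 0)%g = mkL f1 f2 f3 (a + b) 0.
  by rewrite mkLM circ0 mul0mx !addr0.
exists (\matrix_i c i) => a; elim/int_rV_ind: a => [|a b Ea Eb|i].
- rewrite mul0mx -!mkL1; apply: (mulIg (h 1%g)).
  by rewrite -hM !mul1g.
- apply: (mulIg (h (mkL _ _ _ b 0))).
  by rewrite -hM addL subrK Ea Eb addL mulmxBl subrK.
- by rewrite cP -rowE rowK.
Qed.

(** Commutators map to commutators, which gives [DA] for the matrix [A] induced on the centres; the
    three divisibilities follow from this identity and the invertibility of [A]. *)
Lemma model_iso_dvd d1 d2 d3 e1 e2 e3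
    (h : lattice_model d1 d2 d3 -> lattice_model e1 e2 e3) k :
  [/\ (0 < d1)%N, (0 < d2)%N & (0 < d3)%N] ->
  [/\ (0 < e1)%N, (0 < e2)%N & (0 < e3)%N] ->
  (d1 %| d2)%N -> (d2 %| d3)%N -> (e1 %| e2)%N -> (e2 %| e3)%N ->
  {morph h : x y / (x * y)%g} -> {morph k : x y / (x * y)%g} ->
  cancel h k -> cancel k h ->
  [/\ (e1 %| d1)%N, (e3 %| d3)%N & (e1 * e2 * e3 %| d1 * d2 * d3)%N].
Proof.
move=> dp ep d12 d23 e12 e23 hM kM hK kH.
have [A AE] := model_hom_matrix dp ep hM hK kH.
have [A' A'E] := model_hom_matrix ep dp kM kH hK.
have eqmx (M N : 'M[int]_3) : (forall a : 'rV_3, a *m M = a *m N) -> M = N.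
  by move=> MN; apply/row_matrixP => i; rewrite !rowE MN.
have AA' : A *m A' = 1%:M.
  apply: eqmx => a; rewrite mulmx1 mulmxA.
  by have := hK (mkL _ _ _ a 0); rewrite AE A'E => /mkL_inj[].
have A'A : A' *m A = 1%:M by exact: mulmx1C.
(* Row [i] of the diagonal matrix is the commutator of the standard generators i + 1 and i + 2. *)
have /choice[w wP] i : exists w : 'rV[int]_3,
    row i (diag3 int d1 d2 d3) *m A = w *m diag3 int e1 e2 e3.
  pose b := row (i + 1) (1%:M : 'M[int]_3).
  pose b' := row (i + 2) (1%:M : 'M[int]_3).
  have [a1 [c1 E1]] := mkL_surj (h (mkL _ _ _ 0 b)).
  have [a2 [c2 E2]] := mkL_surj (h (mkL _ _ _ 0 b')).
  exists (cross c1 c2).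
  have := congr1 h (mkL_comm d1 d2 d3 0 b 0 b').
  rewrite !hM E1 E2 mkL_comm => /mulIg; rewrite AE => /mkL_inj[+ _].
  have -> : cross b b' = row i 1%:M by rewrite -[in RHS]cofmx1 rowK.
  by rewrite -!row_mul mul1mx.
pose W := \matrix_i w i.
have DA : diag3 int d1 d2 d3 *m A = W *m diag3 int e1 e2 e3.
  by apply/row_matrixP => i; rewrite !row_mul rowK wP.
have DE : diag3 int d1 d2 d3 = W *m diag3 int e1 e2 e3 *m A'.
  by rewrite -DA -mulmxA AA' mulmx1.
have e13 := dvdn_trans e12 e23.
split.
- have : (e1%:Z %| diag3 int d1 d2 d3 0%R 0%R)%Z.
    rewrite DE mxE rpred_sum // => j _; rewrite dvdz_mulr // mul_mx_diag !mxE.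
    by rewrite dvdz_mull //; case: (ord3P j) => ->; rewrite /= natz.
  by rewrite !mxE /= natz.
- have dj i : exists z : int, d3%:Z = z * [:: d1%:R; d2%:R; d3%:R]`_(i : 'I_3).
    apply/dvdzP; case: (ord3P i) => ->; rewrite /= natz //.
    exact: dvdn_trans d23.
  (* In the last column [DA] says that the i-th parameter times [A i 2] is a multiple of [e3], and
     that parameter divides [d3]. *)
  have colA i : (e3%:Z %| d3%:Z * A i 2%R)%Z.
    have [z ->] := dj i; rewrite -mulrA dvdz_mull //.
    have /matrixP/(_ i 2) := DA; rewrite mul_diag_mx mul_mx_diag !mxE /= => ->.
    by rewrite natz dvdz_mull.
  (* This entry of [A'A] writes [d3] as an integer combination of the [d3 * A j 2]. *)
  have /matrixP/(_ 2 2) := A'A; rewrite !mxE eqxx => E.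
  have : (e3%:Z %| d3%:Z * (\sum_j A' 2 j * A j 2)%R)%Z.
    by rewrite mulr_sumr rpred_sum // => j _; rewrite mulrCA dvdz_mull.
  by rewrite E mulr1.
have : (\det (diag3 int e1 e2 e3) %| \det (diag3 int d1 d2 d3))%Z.
  by rewrite DE !det_mulmx -mulrA dvdz_mull // dvdz_mulr.
rewrite !det_diag !big_ord_recl !big_ord0 !mxE /= !mulr1 !mulrA.
by rewrite !natz -!PoszM.
Qed.

Theorem theorem2 (R : realType) (Gam : groupClosed (cotangent_heisenberg R)) :
  lattice Gam ->
  exists! d : nat * nat * nat,
    let: (d1, d2, d3) := d in
    [/\ (0 < d1)%N, (0 < d2)%N & (0 < d3)%N] /\
    [/\ (d1 %| d2)%N, (d2 %| d3)%N &
        group_iso (subgroup_type Gam) (lattice_model d1 d2 d3)].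
Proof.
move=> /adapted_zbases[B [E [d1 [d2 [d3 [Bz Ez dp [d12 d23] cofB]]]]]].
have [f [f' fK f'K]] := lattice_iso_model Bz Ez cofB.
exists (d1, d2, d3); split=> [|[[e1 e2] e3] [ep [e12 e23 [g [g' gK g'K]]]]].
  by do 2![split=> //]; exists f; exists f'.
(* Two models of [Gam] are isomorphic through [Gam]; the divisibilities are then applied in both
   directions. *)
have hM : {morph g \o f' : x y / (x * y)%g}.
  by move=> x y; rewrite /= (can2_gmulfM fK f'K) gmulfM.
have kM : {morph f \o g' : x y / (x * y)%g}.
  by move=> x y; rewrite /= (can2_gmulfM gK g'K) gmulfM.
have hK : cancel (g \o f') (f \o g') by move=> x; rewrite /= gK f'K.
have kH : cancel (f \o g') (g \o f') by move=> x; rewrite /= fK g'K.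
have [ed1 ed3 edprod] := model_iso_dvd dp ep d12 d23 e12 e23 hM kM hK kH.
have [de1 de3 deprod] := model_iso_dvd ep dp e12 e23 d12 d23 kM hM kH hK.
have {ed1 de1} E1 : d1 = e1 by apply/eqP; rewrite eqn_dvd de1 ed1.
have {ed3 de3} E3 : d3 = e3 by apply/eqP; rewrite eqn_dvd de3 ed3.
(* The middle parameter is recovered from the product by cancelling the positive outer ones. *)
have /eqP : (d1 * d2 * d3 == e1 * e2 * e3)%N by rewrite eqn_dvd deprod edprod.
have [d1p _ d3p] := dp; rewrite -E1 -E3 => /eqP.
by rewrite eqn_pmul2r // eqn_pmul2l // => /eqP ->.
Qed.
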